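(* Let $M=(M,+,0)$ be a cancellative commutative monoid such that for all $x,y\in M$ there exists $z\in M$ such that $x=y+z$ or $y=x+z$. Then the lattice $\mathsf{NorSub}(M)$ of normal submonoids of $M$ is isomorphic to the lattice $\mathsf{Sub}(\widehat{M})$ of subgroups of the Grothendieck group $\widehat{M}$ of $M$. In particular, every cancellative commutative monoid satisfying this condition is modular.
   Context: For a monoid $M$ (written multiplicatively, with identity $1$), $U(M)$ denotes its group of units (elements with a two-sided inverse). A groupal submonoid of $M$ is a submonoid $S\subseteq M$ such that $x^{-1}\in S$ for every $x\in S\cap U(M)$. For $A\subseteq M$ and $x,y\in M$, $xAy=\{xay : a\in A\}$. A subset $A\subseteq M$ is invariant if for each $x,y\in M$ the following three conditions are equivalent: (i) $xAy\subseteq A$; (ii) $xy\in A$; (iii) $(xAy)\cap A\neq\emptyset$. A normal submonoid of $M$ is a submonoid which is both groupal and invariant. Commutative monoids are written additively. $\mathsf{NorSub}(M)$, the set of normal submonoids of $M$ ordered by inclusion, is a complete lattice, with meets given by intersection and the join of a family given by the smallest normal submonoid containing the union of the family. $\mathsf{Sub}(\widehat{M})$ is ordered by inclusion. The monoid $M$ is called modular if the lattice $\mathsf{NorSub}(M)$ is modular, i.e. $S_1\vee(S_2\wedge S_3)=(S_1\vee S_2)\wedge S_3$ for all normal submonoids $S_1,S_2,S_3$ of $M$ with $S_1\subseteq S_3$. *)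

(* Defs.v *)
From HB Require Import structures.
From mathcomp Require Import all_boot all_order all_algebra.
From mathcomp Require Import boolp classical_sets.

Set Implicit Arguments.
Unset Strict Implicit.
Unset Printing Implicit Defensive.

Import Order.TTheory GRing.Theory.

Local Open Scope classical_set_scope.

(* A commutative monoid [M : nmodType] is covered by what follows through
   [GRing.to_multiplicative M]: same carrier, product [x + y] and unit [0]. *)
Section NormalSubmonoids.
Variable M : monoidType.
Implicit Types A S : set M.

(* [y] is the two-sided inverse of [x]; thus [x] is a unit iff such a [y] exists. *)
Definition inverse_of (x y : M) : Prop := (x * y = 1 /\ y * x = 1)%g.

Definition submonoid S : Prop := monoid_closed [in S].

Definition groupal S : Prop :=
  forall x y : M, x \in S -> inverse_of x y -> y \in S.

Definition translate (x : M) A (y : M) : set M := [set (x * a * y)%g | a in A].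

Definition invariant_set A : Prop :=
  forall x y : M,
    (translate x A y `<=` A <-> (x * y)%g \in A) /\
    ((x * y)%g \in A <-> translate x A y `&` A !=set0).

Definition normal_submonoid S : Prop :=
  [/\ submonoid S, groupal S & invariant_set S].

Lemma normal_submonoid_bigcap (F : set (set M)) :
  F `<=` normal_submonoid -> normal_submonoid (\bigcap_(S in F) S).
Proof.
move=> nF; have F1 S : F S -> S 1%g by move=> /nF[[/set_mem]].
split; first split.
- by rewrite inE => S /F1.
- move=> x y /set_mem Fx /set_mem Fy; rewrite inE => S FS.
  have [[_ SM] _ _] := nF _ FS.
  by apply: set_mem; apply: SM; rewrite inE; [exact: Fx|exact: Fy].
- move=> x y /set_mem Fx xy; rewrite inE => S FS; have [_ gS _] := nF _ FS.
  by apply: set_mem; apply: gS xy; rewrite inE; apply: Fx.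
move=> x y; have FI : (\bigcap_(S in F) S) 1%g by move=> S /F1.
split; split.
- by move/(_ (x * 1 * y)%g); rewrite mulg1 inE; apply; exists 1%g; rewrite ?mulg1.
- move=> /set_mem Fxy _ [a Fa <-] S FS; have [_ _ iS] := nF _ FS.
  by apply: (iS x y).1.2; [rewrite inE; exact: Fxy|exists a; first exact: Fa].
- move=> /set_mem Fxy; exists (x * y)%g; split=> //.
  by exists 1%g; rewrite ?mulg1.
- move=> [_ [[a Fa <-] Fxay]]; rewrite inE => S FS; have [_ _ iS] := nF _ FS.
  apply: set_mem; apply: (iS x y).2.2; exists (x * a * y)%g.
  by split; [exists a; first exact: Fa|exact: Fxay].
Qed.

End NormalSubmonoids.

Record NorSub (M : monoidType) : Type := MkNorSub {
  norsub_set : set M;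
  norsub_normal : normal_submonoid norsub_set }.

Section NorSubLattice.
Variable M : monoidType.
Implicit Types S T U : NorSub M.

HB.instance Definition _ := gen_eqMixin (NorSub M).
HB.instance Definition _ := gen_choiceMixin (NorSub M).

Lemma norsub_inj : injective (@norsub_set M).
Proof.
by case=> [S nS] [T nT] /= eST; case: _ / eST nT => nT;
congr MkNorSub; exact: Prop_irrelevance.
Qed.

Definition norsub_le S T : bool := `[< norsub_set S `<=` norsub_set T >].

Lemma norsub_le_refl : reflexive norsub_le.
Proof. by move=> S; apply/asboolP. Qed.

Lemma norsub_le_anti : antisymmetric norsub_le.
Proof.
move=> S T /andP[/asboolP ST /asboolP TS].
by apply: norsub_inj; apply/seteqP.
Qed.

Lemma norsub_le_trans : transitive norsub_le.
Proof.
by move=> T S U /asboolP ST /asboolP TU; apply/asboolP; exact: subset_trans TU.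
Qed.

HB.instance Definition _ := Order.Le_isPOrder.Build set_display (NorSub M)
  norsub_le_refl norsub_le_anti norsub_le_trans.

Lemma norsub_leP S T : reflect (norsub_set S `<=` norsub_set T) (S <= T)%O.
Proof. exact: asboolP. Qed.

Lemma norsub_meet_normal S T :
  normal_submonoid (norsub_set S `&` norsub_set T).
Proof.
have -> : norsub_set S `&` norsub_set T =
    \bigcap_(A in [set norsub_set S; norsub_set T]) A.
  by apply/seteqP; split=> [x [Sx Tx] _ [->|->]//|x STx];
     split; apply: STx; [left|right].
by apply: normal_submonoid_bigcap => _ [->|->]; apply: norsub_normal.
Qed.

Definition norsub_meet S T : NorSub M := MkNorSub (norsub_meet_normal S T).

Lemma norsub_join_normal S T :
  normal_submonoid
    (smallest (@normal_submonoid M) (norsub_set S `|` norsub_set T)).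
Proof. by apply: normal_submonoid_bigcap => A []. Qed.

Definition norsub_join S T : NorSub M := MkNorSub (norsub_join_normal S T).

Lemma norsub_meetP S T U :
  (S <= norsub_meet T U)%O = (S <= T)%O && (S <= U)%O.
Proof.
apply/norsub_leP/andP => [|[/norsub_leP ST /norsub_leP SU]]; last first.
  by rewrite subsetI.
by rewrite subsetI => -[? ?]; split; apply/norsub_leP.
Qed.

Lemma norsub_joinP S T U :
  (norsub_join S T <= U)%O = (S <= U)%O && (T <= U)%O.
Proof.
apply/norsub_leP/andP => [STU|[/norsub_leP SU /norsub_leP TU]].
  by split; apply/norsub_leP => x Sx; apply: STU; apply: sub_gen_smallest;
     [left|right].
by apply: smallest_sub; [exact: norsub_normal|rewrite subUset].
Qed.

HB.instance Definition _ :=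
  Order.POrder_MeetJoin_isLattice.Build set_display (NorSub M)
    norsub_meetP norsub_joinP.

End NorSubLattice.

Definition modular_monoid (M : monoidType) : Prop :=
  forall S1 S2 S3 : NorSub M, (S1 <= S3)%O ->
    (S1 `|` (S2 `&` S3) = (S1 `|` S2) `&` S3)%O.

Definition subgroup (G : zmodType) (H : set G) : Prop := zmod_closed [in H].

Lemma subgroup_bigcap (G : zmodType) (F : set (set G)) :
  F `<=` @subgroup G -> subgroup (\bigcap_(H in F) H).
Proof.
move=> sF; split; first by rewrite inE => H /sF[/set_mem].
move=> x y /set_mem Fx /set_mem Fy; rewrite inE => H FH.
have [_ HB] := sF _ FH.
by apply: set_mem; apply: HB; rewrite inE; [exact: Fx|exact: Fy].
Qed.

Record Subgroups (G : zmodType) : Type := MkSubgroup {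
  sub_set : set G;
  sub_subgroup : subgroup sub_set }.

Section SubLattice.
Variable G : zmodType.
Implicit Types H K L : Subgroups G.

HB.instance Definition _ := gen_eqMixin (Subgroups G).
HB.instance Definition _ := gen_choiceMixin (Subgroups G).

Lemma sub_set_inj : injective (@sub_set G).
Proof.
by case=> [H sH] [K sK] /= eHK; case: _ / eHK sK => sK;
congr MkSubgroup; exact: Prop_irrelevance.
Qed.

Definition sub_le H K : bool := `[< sub_set H `<=` sub_set K >].

Lemma sub_le_refl : reflexive sub_le.
Proof. by move=> H; apply/asboolP. Qed.

Lemma sub_le_anti : antisymmetric sub_le.
Proof.
move=> H K /andP[/asboolP HK /asboolP KH].
by apply: sub_set_inj; apply/seteqP.
Qed.

Lemma sub_le_trans : transitive sub_le.
Proof.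
by move=> K H L /asboolP HK /asboolP KL; apply/asboolP; exact: subset_trans KL.
Qed.

HB.instance Definition _ := Order.Le_isPOrder.Build set_display (Subgroups G)
  sub_le_refl sub_le_anti sub_le_trans.

Lemma sub_leP H K : reflect (sub_set H `<=` sub_set K) (H <= K)%O.
Proof. exact: asboolP. Qed.

Lemma sub_meet_subgroup H K : subgroup (sub_set H `&` sub_set K).
Proof.
have -> : sub_set H `&` sub_set K =
    \bigcap_(A in [set sub_set H; sub_set K]) A.
  by apply/seteqP; split=> [x [Hx Kx] _ [->|->]//|x HKx];
     split; apply: HKx; [left|right].
by apply: subgroup_bigcap => _ [->|->]; apply: sub_subgroup.
Qed.

Definition sub_meet H K : Subgroups G := MkSubgroup (sub_meet_subgroup H K).

Lemma sub_join_subgroup H K :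
  subgroup (smallest (@subgroup G) (sub_set H `|` sub_set K)).
Proof. by apply: subgroup_bigcap => A []. Qed.

Definition sub_join H K : Subgroups G := MkSubgroup (sub_join_subgroup H K).

Lemma sub_meetP H K L : (H <= sub_meet K L)%O = (H <= K)%O && (H <= L)%O.
Proof.
apply/sub_leP/andP => [|[/sub_leP HK /sub_leP HL]]; last by rewrite subsetI.
by rewrite subsetI => -[? ?]; split; apply/sub_leP.
Qed.

Lemma sub_joinP H K L : (sub_join H K <= L)%O = (H <= L)%O && (K <= L)%O.
Proof.
apply/sub_leP/andP => [HKL|[/sub_leP HL /sub_leP KL]].
  by split; apply/sub_leP => x Hx; apply: HKL; apply: sub_gen_smallest;
     [left|right].
by apply: smallest_sub; [exact: sub_subgroup|rewrite subUset].
Qed.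

HB.instance Definition _ :=
  Order.POrder_MeetJoin_isLattice.Build set_display (Subgroups G)
    sub_meetP sub_joinP.

End SubLattice.

Section Grothendieck.
Local Open Scope ring_scope.
Local Open Scope quotient_scope.
Variable M : nmodType.
Implicit Types p q r : M * M.

(* The pair [(a, b)] stands for the formal difference [a - b]. *)
Definition groth_equiv p q : bool :=
  `[< exists k : M, p.1 + q.2 + k = q.1 + p.2 + k >].

Lemma groth_equiv_refl : reflexive groth_equiv.
Proof. by move=> p; apply/asboolP; exists 0. Qed.

Lemma groth_equiv_sym : symmetric groth_equiv.
Proof. by move=> p q; apply/asboolP/asboolP => -[k e]; exists k. Qed.

Lemma groth_equiv_trans : transitive groth_equiv.
Proof.
move=> q p r /asboolP[k e] /asboolP[l f]; apply/asboolP.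
exists (q.2 + q.1 + k + l).
transitivity ((p.1 + q.2 + k) + (q.1 + r.2 + l)).
  by rewrite (AC (2*4) ((1*3*5)*(4*2*6))).
by rewrite e f (AC ((2*1)*(2*1)) ((4*2)*(5*1*3*6))).
Qed.

Canonical groth_equiv_equiv :=
  EquivRel groth_equiv groth_equiv_refl groth_equiv_sym groth_equiv_trans.

Definition grothendieck := {eq_quot groth_equiv}.

HB.instance Definition _ : EqQuotient _ groth_equiv grothendieck :=
  EqQuotient.on grothendieck.
HB.instance Definition _ := Choice.on grothendieck.

Definition groth_add_pair p q : M * M := (p.1 + q.1, p.2 + q.2).
Definition groth_add := lift_op2 grothendieck groth_add_pair.

Lemma groth_equiv_add p p' q q' :
  groth_equiv p p' -> groth_equiv q q' ->
  groth_equiv (groth_add_pair p q) (groth_add_pair p' q').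
Proof.
move=> /asboolP[k e] /asboolP[l f]; apply/asboolP; exists (k + l) => /=.
transitivity ((p.1 + p'.2 + k) + (q.1 + q'.2 + l)).
  by rewrite (AC (2*2*2) ((1*3*5)*(2*4*6))).
by rewrite e f (AC (3*3) ((1*4)*(2*5)*(3*6))).
Qed.

Lemma pi_groth_add : {morph \pi : p q / groth_add_pair p q >-> groth_add p q}.
Proof.
move=> p q; unlock groth_add; apply/eqmodP; rewrite /=.
by apply: groth_equiv_add; apply/eqmodP; rewrite reprK.
Qed.
Canonical pi_groth_add_morph := PiMorph2 pi_groth_add.

Definition groth_opp_pair p : M * M := (p.2, p.1).
Definition groth_opp := lift_op1 grothendieck groth_opp_pair.

Lemma groth_equiv_opp p p' :
  groth_equiv p p' -> groth_equiv (groth_opp_pair p) (groth_opp_pair p').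
Proof.
move=> /asboolP[k e]; apply/asboolP; exists k => /=.
by rewrite [p.2 + _]addrC -e [p.1 + _]addrC.
Qed.

Lemma pi_groth_opp : {morph \pi : p / groth_opp_pair p >-> groth_opp p}.
Proof.
move=> p; unlock groth_opp; apply/eqmodP; rewrite /=.
by apply: groth_equiv_opp; apply/eqmodP; rewrite reprK.
Qed.
Canonical pi_groth_opp_morph := PiMorph1 pi_groth_opp.

Definition groth_zero : grothendieck := \pi_grothendieck (0, 0).

Lemma groth_addA : associative groth_add.
Proof.
elim/quotW=> p; elim/quotW=> q; elim/quotW=> r; rewrite !piE.
by rewrite /groth_add_pair !addrA.
Qed.

Lemma groth_addC : commutative groth_add.
Proof.
elim/quotW=> p; elim/quotW=> q; rewrite !piE.
by rewrite /groth_add_pair addrC [p.2 + _]addrC.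
Qed.

Lemma groth_add0 : left_id groth_zero groth_add.
Proof.
by elim/quotW=> -[a b]; rewrite /groth_zero !piE /groth_add_pair /= !add0r.
Qed.

Lemma groth_addN : left_inverse groth_zero groth_opp groth_add.
Proof.
elim/quotW=> -[a b]; rewrite /groth_zero !piE; apply/eqmodP/asboolP.
by exists 0; rewrite /= !addr0 add0r addrC.
Qed.

HB.instance Definition _ := GRing.isZmodule.Build grothendieck
  groth_addA groth_addC groth_add0 groth_addN.

Definition to_grothendieck (x : M) : grothendieck := \pi_grothendieck (x, 0).

Lemma to_grothendieck_is_nmod_morphism : nmod_morphism to_grothendieck.
Proof.
split=> // x y; rewrite -[RHS]/(groth_add _ _) /to_grothendieck !piE.
by rewrite /groth_add_pair /= addr0.
Qed.

HB.instance Definition _ :=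
  GRing.isNmodMorphism.Build M grothendieck to_grothendieck
    to_grothendieck_is_nmod_morphism.

Lemma grothendieck_pairE (a b : M) :
  \pi_grothendieck (a, b) = to_grothendieck a - to_grothendieck b.
Proof.
rewrite -[RHS]/(groth_add _ (groth_opp _)) /to_grothendieck !piE.
by rewrite /groth_add_pair /groth_opp_pair /= addr0 add0r.
Qed.

Lemma to_grothendieck_eq (a b : M) :
  to_grothendieck a = to_grothendieck b <-> exists k, a + k = b + k.
Proof.
split=> [/eqmodP/asboolP[k /=]|[k e]]; first by rewrite !addr0; exists k.
by apply/eqmodP/asboolP; exists k; rewrite /= !addr0.
Qed.

End Grothendieck.

Section UniversalProperty.
Local Open Scope ring_scope.
Variables (M : nmodType) (G : zmodType) (f : {additive M -> G}).
Local Notation iota := (@to_grothendieck M).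

Definition groth_lift (u : grothendieck M) : G := f (repr u).1 - f (repr u).2.

Lemma groth_liftE (a b : M) :
  groth_lift (\pi_(grothendieck M) (a, b))%qT = f a - f b.
Proof.
rewrite /groth_lift; case: piP => -[c d] /eqmodP/asboolP[k /= e].
have /(congr1 f) := e; rewrite !raddfD => /addIr e'.
by apply/eqP; rewrite subr_eq addrAC e' addrK.
Qed.

Lemma groth_lift_is_zmod_morphism : zmod_morphism groth_lift.
Proof.
elim/quotW=> -[a b]; elim/quotW=> -[c d].
have -> : (\pi_(grothendieck M) (a, b) - \pi_(grothendieck M) (c, d))%qT
          = (\pi_(grothendieck M) (a + d, b + c))%qT.
  rewrite !grothendieck_pairE !(raddfD iota) opprB addrACA -opprD.
  by rewrite addrC.
by rewrite !groth_liftE !(raddfD f) opprB addrACA -opprD [f b + _]addrC.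
Qed.

HB.instance Definition _ :=
  GRing.isZmodMorphism.Build (grothendieck M) G groth_lift
    groth_lift_is_zmod_morphism.

Lemma grothendieck_universal :
  exists2 g : {additive grothendieck M -> G},
    forall x, g (iota x) = f x &
    forall h : {additive grothendieck M -> G},
      (forall x, h (iota x) = f x) -> h =1 g.
Proof.
have gE x : groth_lift (iota x) = f x by rewrite groth_liftE raddf0 subr0.
exists groth_lift => // h hE; elim/quotW=> -[a b].
by rewrite grothendieck_pairE raddfB !hE -!gE -raddfB.
Qed.

End UniversalProperty.

Definition lattice_isomorphic (d : Order.disp_t) (L : latticeType d)
    (d' : Order.disp_t) (L' : latticeType d') : Prop :=
  exists f : {lmorphism L -> L'}, bijective f.

(* Main.v *)
(* A normal submonoid [A] is sent to the subgroup of differences [a - b] with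
   [a, b] in [A], a subgroup [H] to the trace of [H] on [M]. Taking the trace of
   the differences of [A] gives [A] back, because [M] is cancellative and [A]
   contains [y] as soon as it contains [x] and [x + y]. Conversely, totality
   makes every element of the Grothendieck group equal to [z] or [- z] for some
   [z] in [M], so a subgroup is determined by its trace. Modularity is then
   inherited from the subgroup lattice of an abelian group. *)
Require Import Defs.
From HB Require Import structures.
From mathcomp Require Import all_boot all_order all_algebra.
From mathcomp Require Import boolp classical_sets.

Import Order.TTheory GRing.Theory.

Section OrderIsomorphism.
Context {d d' : Order.disp_t} {L : latticeType d} {L' : latticeType d'}.
Variables (f : L -> L') (g : L' -> L).
Hypotheses (fK : cancel f g) (gK : cancel g f).
Hypotheses (f_homo : {homo f : x y / (x <= y)%O})
           (g_homo : {homo g : x y / (x <= y)%O}).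

Lemma order_iso_meet : Order.meet_morphism f.
Proof.
move=> x y; apply: le_anti; rewrite lexI !f_homo ?leIl ?leIr //=.
(* For the remaining inequality, write [f x]&[f y] as [f] of its image under [g]; that image lies
   below [x] and [y] because [g] is monotone and inverts [f]. *)
rewrite -[X in (X <= _)%O]gK; apply: f_homo.
rewrite lexI -[X in (_ <= X)%O && _]fK -[X in _ && (_ <= X)%O]fK.
by rewrite !g_homo ?leIl ?leIr.
Qed.

Lemma order_iso_join : Order.join_morphism f.
Proof.
move=> x y; apply: le_anti; rewrite leUx !f_homo ?leUl ?leUr //= andbT.
rewrite -[X in (_ <= X)%O]gK; apply: f_homo.
rewrite leUx -[X in (X <= _)%O && _]fK -[X in _ && (X <= _)%O]fK.
by rewrite !g_homo ?leUl ?leUr.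
Qed.

Lemma order_iso_lattice_isomorphic : lattice_isomorphic L L'.
Proof.
pose h : {lmorphism L -> L'} := HB.pack f
  (Order.isOrderMorphism.Build _ _ _ _ f f_homo)
  (Order.isMeetLatticeMorphism.Build _ _ _ _ f order_iso_meet)
  (Order.isJoinLatticeMorphism.Build _ _ _ _ f order_iso_join).
by exists h; exists g.
Qed.

End OrderIsomorphism.

Section SubgroupModularity.
Local Open Scope classical_set_scope.
Local Open Scope ring_scope.
Variable G : zmodType.
Implicit Types H K : Subgroups G.

Lemma subgroup0 H : sub_set H 0.
Proof. by have [/set_mem] := sub_subgroup H. Qed.

Lemma subgroupB H x y : sub_set H x -> sub_set H y -> sub_set H (x - y).
Proof.
move=> Hx Hy; apply: set_mem; have [_ closed] := sub_subgroup H.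
by apply: closed; rewrite inE.
Qed.

Lemma subgroupN H x : sub_set H x -> sub_set H (- x).
Proof. by move=> Hx; rewrite -sub0r; apply: subgroupB (subgroup0 H) Hx. Qed.

Lemma subgroupD H x y : sub_set H x -> sub_set H y -> sub_set H (x + y).
Proof.
by move=> Hx Hy; rewrite -[y]opprK; apply: subgroupB (subgroupN _ _ Hy).
Qed.

(** In an abelian group the sums [a + b] already form a subgroup containing [H] and [K], so the
    smallest such subgroup consists of sums. *)
Lemma sub_join_sum H K x : sub_set (H `|` K)%O x ->
  exists a b, [/\ sub_set H a, sub_set K b & x = a + b].
Proof.
pose S : set G :=
  [set x | exists a b, [/\ sub_set H a, sub_set K b & x = a + b]].
have sS : subgroup S.
  split; first by rewrite inE; exists 0, 0; split; rewrite ?addr0 //;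
    apply: subgroup0.
  move=> _ _ /set_mem[a [b [Ha Kb ->]]] /set_mem[a' [b' [Ha' Kb' ->]]].
  rewrite inE; exists (a - a'), (b - b').
  by split; [exact: subgroupB|exact: subgroupB|rewrite opprD addrACA].
move=> HKx; apply: (HKx S); split=> // y [Hy|Ky].
  by exists y, 0; rewrite addr0; split=> //; apply: subgroup0.
by exists 0, y; rewrite add0r; split=> //; apply: subgroup0.
Qed.

(** One inequality holds in every lattice. For the other, if [a + b] is in [H3] with [a] in [H1],
    hence in [H3], then subtracting [a] puts [b] in [H3] as well. *)
Lemma subgroups_modular (H1 H2 H3 : Subgroups G) : (H1 <= H3)%O ->
  (H1 `|` (H2 `&` H3) = (H1 `|` H2) `&` H3)%O.
Proof.
move=> le13; apply: le_anti; apply/andP; split.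
  by rewrite leUx !lexI leUl le13 /= leIr andbT (le_trans (leIl _ _)) ?leUr.
apply/sub_leP => x [/sub_join_sum[a [b [H1a H2b ->]]] H3ab].
have H3b : sub_set H3 b.
  rewrite -[b](addKr a) addrC; apply: subgroupB H3ab _.
  by move/sub_leP: le13; apply.
apply: subgroupD.
  by have /sub_leP := leUl H1 (H2 `&` H3)%O; apply.
by have /sub_leP := leUr (H2 `&` H3)%O H1; apply.
Qed.

End SubgroupModularity.

Section NormalSubmonoidsOfCommutativeMonoids.
Local Open Scope classical_set_scope.
Local Open Scope ring_scope.
Variable M : nmodType.
Implicit Types (A : set M) (S : NorSub (GRing.to_multiplicative M)).

(** By commutativity invariance depends only on [x + y], and for a submonoid it amounts to the last
    closure condition, which also yields groupality. *)
Lemma normal_submonoid_commP A :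
  @normal_submonoid (GRing.to_multiplicative M) A <->
  [/\ A 0, forall x y, A x -> A y -> A (x + y)
         & forall x y, A x -> A (x + y) -> A y].
Proof.
split=> [[[/set_mem A0 AD] _ invA]|[A0 AD AB]].
  split=> // [x y Ax Ay|x y Ax Axy]; first by apply/set_mem/AD; rewrite inE.
  (* Invariance at the pair [(0, y)]: the element [x + y] lies both in [A] and in the translate of
     [A] by this pair. *)
  have [_ [_ meetA]] := invA (0 : M) y.
  have /set_mem : ((0 : M) + y)%R \in A; last by rewrite add0r.
  apply: meetA; exists (x + y); split=> //.
  by exists x => //=; rewrite -[RHS](congr1 (+%R^~ y) (add0r x)).
split.
- split; first by rewrite inE.
  by move=> x y /set_mem Ax /set_mem Ay; rewrite inE; apply: AD.
(* If [y] is the inverse of [x], then [x + y = 0] is in [A]. *)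
- move=> x y /set_mem Ax [xy _]; rewrite inE; apply: AB Ax _.
  by rewrite -[x + y]/((x : GRing.to_multiplicative M) * y)%g xy.
move=> x y.
(* The two-sided translate is the shift by [x + y]. *)
have translateE a :
    ((x : GRing.to_multiplicative M) * a * y)%g = a + (x + y) :> M.
  by rewrite -[LHS]/(x + a + y)%R addrCA -addrA.
rewrite inE; split; split.
- move=> /(_ (x * 1 * y)%g); rewrite mulg1; apply.
  by exists 1%g; rewrite ?mulg1.
- by move=> Axy _ [a Aa <-]; rewrite translateE; apply: AD.
- move=> Axy; exists (0 + (x + y)); split; last by rewrite add0r.
  by exists 0 => //; rewrite translateE.
- by move=> [_ [[a Aa <-]]]; rewrite translateE; apply: AB.
Qed.

Local Notation iota := (@to_grothendieck M).

Lemma grothendieck_ind (P : grothendieck M -> Prop) :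
  (forall a b, P (iota a - iota b)) -> forall u, P u.
Proof.
by move=> PB; elim/quotW => -[a b]; rewrite grothendieck_pairE.
Qed.

Lemma norsub_differences_subgroup S :
  subgroup [set u | exists a b, [/\ norsub_set S a, norsub_set S b
                                  & u = iota a - iota b]].
Proof.
have /normal_submonoid_commP[S0 SD _] := norsub_normal S.
split; first by rewrite inE; exists 0, 0; rewrite subrr.
move=> _ _ /set_mem[a [b [Sa Sb ->]]] /set_mem[a' [b' [Sa' Sb' ->]]].
rewrite inE; exists (a + b'), (b + a'); split; [exact: SD|exact: SD|].
by rewrite !(raddfD iota) opprB opprD addrACA.
Qed.

(** The closure condition on [x] and [x + y] comes from subtraction in [H]: [iota y] is
    [iota (x + y) - iota x]. *)
Lemma subgroup_trace_normal (H : Subgroups (grothendieck M)) :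
  @normal_submonoid (GRing.to_multiplicative M) (iota @^-1` sub_set H).
Proof.
apply/normal_submonoid_commP; split=> /=.
- by rewrite raddf0; apply: subgroup0.
- by move=> x y; rewrite raddfD; apply: subgroupD.
- move=> x y Hx; rewrite raddfD => Hxy.
  by rewrite -[iota y](addKr (iota x)) addrC; apply: subgroupB.
Qed.

Definition norsub_differences S : Subgroups (grothendieck M) :=
  MkSubgroup (norsub_differences_subgroup S).

Definition subgroup_trace (H : Subgroups (grothendieck M)) :
    NorSub (GRing.to_multiplicative M) :=
  MkNorSub (subgroup_trace_normal H).

Lemma norsub_differences_homo :
  {homo norsub_differences : S T / (S <= T)%O}.
Proof.
move=> S T /norsub_leP ST; apply/sub_leP => _ [a [b [Sa Sb ->]]].
by exists a, b; split=> //; apply: ST.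
Qed.

Lemma subgroup_trace_homo : {homo subgroup_trace : H K / (H <= K)%O}.
Proof.
by move=> H K /sub_leP HK; apply/norsub_leP => x; apply: HK.
Qed.

Lemma norsub_differencesK :
  (forall x y z : M, x + y = x + z -> y = z) ->
  cancel norsub_differences subgroup_trace.
Proof.
move=> cancelM S; have /normal_submonoid_commP[S0 _ SB] := norsub_normal S.
apply/norsub_inj/seteqP; split=> x /= => [[a [b [Sa Sb]]]|Sx]; last first.
  by exists x, 0; rewrite (raddf0 iota) subr0.
(* Equality in the Grothendieck group holds up to a common summand [k]; cancelling it leaves
   [a = x + b] with [a] and [b] in [S]. *)
move/eqP; rewrite eq_sym subr_eq -raddfD => /eqP/to_grothendieck_eq[k].
by rewrite ![_ + k]addrC => /cancelM ab; apply: SB Sb _; rewrite addrC -ab.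
Qed.

Lemma subgroup_traceK :
  (forall x y : M, exists z, x = y + z \/ y = x + z) ->
  cancel subgroup_trace norsub_differences.
Proof.
move=> totalM H; apply/sub_set_inj/seteqP; split=> u.
  by move=> [a [b [Ha Hb ->]]]; apply: subgroupB.
(* The difference [iota a - iota b] collapses to [iota z] or [- iota z]. Either way [z] is in the
   trace, and the pair [z, 0] or [0, z] exhibits the difference. *)
elim/grothendieck_ind: u => a b; have [z [->|->]] := totalM a b.
  rewrite (raddfD iota) addrAC subrr add0r => Hz.
  exists z, 0; rewrite (raddf0 iota) subr0; split=> //=.
  by rewrite raddf0; apply: subgroup0.
rewrite (raddfD iota) opprD addNKr => Hz.
exists 0, z; rewrite (raddf0 iota) sub0r; split=> //=.
  by rewrite raddf0; apply: subgroup0.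
by rewrite -[iota z]opprK; apply: subgroupN.
Qed.

End NormalSubmonoidsOfCommutativeMonoids.

Theorem theorem2p27 (M : nmodType)
  (cancelM : forall x y z : M, (x + y = x + z)%R -> y = z)
  (totalM : forall x y : M, exists z : M, (x = y + z)%R \/ (y = x + z)%R) :
  lattice_isomorphic (NorSub (GRing.to_multiplicative M))
                     (Subgroups (grothendieck M)) /\
  modular_monoid (GRing.to_multiplicative M).
Proof.
have iso : lattice_isomorphic (NorSub (GRing.to_multiplicative M))
    (Subgroups (grothendieck M)).
  exact: order_iso_lattice_isomorphic (norsub_differencesK M cancelM)
    (subgroup_traceK M totalM) (@norsub_differences_homo M)
    (@subgroup_trace_homo M).
split=> // S1 S2 S3 le13; have [f /bij_inj f_inj] := iso.
have fI x y : f (x `&` y)%O = (f x `&` f y)%O := omorphI f x y.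
have fU x y : f (x `|` y)%O = (f x `|` f y)%O := omorphU f x y.
(* Since [f] is injective and preserves meets and joins, the modular identity can be checked on the
   images, which are subgroups. *)
apply: f_inj; rewrite !(fI, fU).
by apply: subgroups_modular; apply: omorph_le.
Qed.
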